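(* Let $X_1,\dots,X_m\in\mathbb{M}_n$. Then there exists a unitary $V\in\mathbb{M}_n$ such that, for any $\beta>0$, $$ \left|\sum_{k=1}^m X_k\right|_{\mathrm{sym}} \le \beta\left\{\sum_{k=1}^m |X_k|_{\mathrm{sym}}\right\}+\frac{1}{8\beta}\left\{V\left(\sum_{k=1}^m |X_k|\right)V^*+V^*\left(\sum_{k=1}^m |X_k^*|\right)V\right\}. $$
   Context: $\mathbb{M}_n$ is the space of complex $n\times n$ matrices. For $Z\in\mathbb{M}_n$, $|Z|=(Z^*Z)^{1/2}$ is the absolute value and $|Z|_{\mathrm{sym}}=\frac{|Z|+|Z^*|}{2}$ is the symmetric modulus. The relation $\le$ between Hermitian matrices is the Loewner order ($S\le T$ iff $T-S$ is positive semidefinite). *)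

(* Defs.v *)
From mathcomp Require Import all_boot all_order all_algebra.
From mathcomp Require Export complex.
From mathcomp Require Export reals.

Set Implicit Arguments.
Unset Strict Implicit.
Unset Printing Implicit Defensive.

Import Order.TTheory GRing.Theory Num.Theory.
Local Open Scope ring_scope.
Local Open Scope sesquilinear_scope.

Section SymmetricModulus.
Variables (C : numClosedFieldType) (n : nat).
Implicit Types A B S T Z : 'M[C]_n.

(* In a numClosedFieldType, [0 <= z] means that z is a nonnegative real. *)
Definition psdmx A : Prop :=
  A \is hermsymmx /\ forall v : 'cV[C]_n, 0 <= (v ^t* *m A *m v) 0 0.

Definition loewner_le S T : Prop := psdmx (T - S).

(* Spectral calculus: [A = invmx P *m diag_mx d *m P] with P unitary whenever
   A is normal; meaningful for A psd, see [sqrtmxP] and [sqrtmx_unique]. *)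
Definition sqrtmx A : 'M[C]_n :=
  invmx (spectralmx A) *m diag_mx (map_mx sqrtC (spectral_diag A))
    *m spectralmx A.

Definition absmx Z : 'M[C]_n := sqrtmx (Z ^t* *m Z).

Definition symabsmx Z : 'M[C]_n := 2^-1 *: (absmx Z + absmx (Z ^t*)).

Lemma trmxC_mul m p q (M : 'M[C]_(m, p)) (N : 'M[C]_(p, q)) :
  (M *m N) ^t* = N ^t* *m M ^t*.
Proof. by rewrite trmx_mul map_mxM. Qed.

Lemma hermsymmxP A : reflect (A ^t* = A) (A \is hermsymmx).
Proof.
rewrite qualifE /= expr0 scale1r.
by apply: (iffP eqP) => [{2}->|->].
Qed.

Lemma gram_psd m (Z : 'M[C]_(m, n)) : psdmx (Z ^t* *m Z).
Proof.
split; first by apply/hermsymmxP; rewrite trmxC_mul trmxCK.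
move=> v; rewrite mulmxA -trmxC_mul -mulmxA mxE sumr_ge0 // => i _.
by rewrite !mxE mulrC mul_conjC_ge0.
Qed.

Lemma psd_spectral A : psdmx A ->
  A = (spectralmx A) ^t* *m diag_mx (spectral_diag A) *m spectralmx A
  /\ forall i, 0 <= spectral_diag A 0 i.
Proof.
case=> hA pA; have uP := spectral_unitarymx A.
have eqA : A = (spectralmx A) ^t* *m diag_mx (spectral_diag A) *m spectralmx A.
  by rewrite -invmx_unitary //; apply/orthomx_spectralP/hermitian_normalmx.
split=> // i.
move: (spectralmx A) (spectral_diag A) uP eqA => P d /unitarymxP PP eqA.
have := pA (P ^t* *m delta_mx i 0).
rewrite trmxC_mul trmxCK eqA !mulmxA -(mulmxA _ P) PP mulmx1.
rewrite -(mulmxA _ P) PP mulmx1 trmx_delta map_delta_mx -rowE -colE !mxE.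
by rewrite eqxx mulr1n.
Qed.

Lemma conj_diag_psd (P : 'M[C]_n) (d : 'rV[C]_n) :
  (forall i, 0 <= d 0 i) -> psdmx (P ^t* *m diag_mx d *m P).
Proof.
move=> d0; set r := diag_mx (map_mx sqrtC d).
have rr : diag_mx d = r ^t* *m r.
  rewrite /r tr_diag_mx map_diag_mx mulmx_diag; congr diag_mx.
  apply/rowP => i; rewrite !mxE.
  rewrite -[LHS]sqrtCK expr2; congr (_ * _); apply: esym.
  by apply: geC0_conj; rewrite sqrtC_ge0.
by rewrite rr mulmxA -trmxC_mul -mulmxA; apply: gram_psd.
Qed.

Lemma sqrtmxP A : psdmx A -> psdmx (sqrtmx A) /\ sqrtmx A *m sqrtmx A = A.
Proof.
move=> /psd_spectral[eqA d0]; have uP := spectral_unitarymx A.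
rewrite /sqrtmx invmx_unitary //.
move: (spectralmx A) (spectral_diag A) uP eqA d0 => P d uP -> d0.
have /unitarymxP PP := uP; split.
  by apply: conj_diag_psd => i; rewrite mxE sqrtC_ge0.
rewrite !mulmxA -(mulmxA _ P) PP mulmx1 -[X in X *m P]mulmxA mulmx_diag.
congr (_ *m diag_mx _ *m _); apply/rowP => i.
by rewrite !mxE -expr2 sqrtCK.
Qed.

Lemma psd_sqr_inj A B : psdmx A -> psdmx B -> A *m A = B *m B -> A = B.
Proof.
move=> /psd_spectral[eA a0] /psd_spectral[eB b0].
have := spectral_unitarymx A; have := spectral_unitarymx B.
move: (spectralmx A) (spectralmx B) (spectral_diag A) (spectral_diag B)
  eA eB a0 b0 => P Q a b -> -> a0 b0 uQ uP.
have /unitarymxP PP := uP; have /unitarymxP QQ := uQ.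
have QQ' := mulmx1C QQ; have PP' := mulmx1C PP.
rewrite !mulmxA -(mulmxA _ P) PP mulmx1 -(mulmxA _ Q) QQ mulmx1 => E.
have {}E : (diag_mx a *m diag_mx a) *m (P *m Q ^t*)
         = (P *m Q ^t*) *m (diag_mx b *m diag_mx b).
  move/(congr1 (fun M => P *m M *m Q ^t*)): E.
  by rewrite !mulmxA PP mul1mx -[in RHS](mulmxA _ Q) QQ mulmx1.
have {}E : diag_mx a *m (P *m Q ^t*) = (P *m Q ^t*) *m diag_mx b.
  move: E; rewrite !mulmx_diag; move: (P *m Q ^t*) => W E.
  apply/matrixP => i j; have /matrixP/(_ i j) := E.
  rewrite !mul_diag_mx !mul_mx_diag !mxE.
  have [->|w0] := eqVneq (W i j) 0; first by rewrite !mulr0 !mul0r.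
  rewrite [RHS]mulrC => /(mulIf w0) /eqP.
  rewrite -!expr2 eqrXn2 // => /eqP ->.
  by rewrite mulrC.
move/(congr1 (fun M => P ^t* *m M *m Q)): E.
by rewrite !mulmxA -!(mulmxA _ (Q ^t*)) QQ' mulmx1 PP' mul1mx.
Qed.

Lemma sqrtmx_unique A B : psdmx A -> psdmx B -> B *m B = A -> B = sqrtmx A.
Proof.
move=> pA pB BB; have [pS SS] := sqrtmxP pA.
by apply: psd_sqr_inj; rewrite ?SS.
Qed.

End SymmetricModulus.

(* Main.v *)
Require Import Defs.
From mathcomp Require Import all_boot all_order all_algebra.
From mathcomp Require Import complex reals.
From mathcomp Require Import ring.

Set Implicit Arguments.
Unset Strict Implicit.
Unset Printing Implicit Defensive.

Import Order.TTheory GRing.Theory Num.Theory.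
Local Open Scope ring_scope.
Local Open Scope sesquilinear_scope.

(** Let [S] be the sum of the [X k], put [A := \sum_k |(X k)^*|] and
    [B := \sum_k |X k|], and let [S = V |S|] be a polar decomposition with [V]
    unitary; this [V] is the one of the theorem.

    If [X = W |X|] with [W] unitary, then [|X^*| = W |X| W^*], so for real [t]
    the congruence of [|X|] by [t W^* V - 1] expands into
    [t^2 V^* |X^*| V + |X| - t (V^* X + X^* V)], which is therefore positive
    semidefinite ([psdmx_polar_square]).  This is additive in [X]: summing over
    [k] and using [V^* S = |S| = S^* V] gives
      [2 t |S| <= t^2 V^* A V + B]                    ([absmx_sum_le]),
    and conjugating by [V], since [|S^*| = V |S| V^*],
      [2 t |S^*| <= t^2 A + V B V^*]                  ([absmx_adj_sum_le]).
    The claim is [b / 2] times the first inequality at [t = 1 / (2 b)] plus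
    [1 / (8 b)] times the second at [t = 2 b].

    The polar decomposition with a unitary (and not just partially isometric)
    factor comes from a general fact: two square matrices with the same Gram
    matrix differ by a unitary factor ([gram_eq_unitary]). *)

(** * Positive semidefinite matrices and absolute values *)

Section PositiveSemidefinite.
Variables (C : numClosedFieldType) (n : nat).
Implicit Types A B Z : 'M[C]_n.

Lemma trmxC_add m p (M N : 'M[C]_(m, p)) : (M + N) ^t* = M ^t* + N ^t*.
Proof. by rewrite linearD map_mxD. Qed.

Lemma trmxC_sub m p (M N : 'M[C]_(m, p)) : (M - N) ^t* = M ^t* - N ^t*.
Proof. by rewrite linearB map_mxB. Qed.

Lemma trmxC_scale m p (c : C) (M : 'M[C]_(m, p)) :
  (c *: M) ^t* = c^* *: M ^t*.
Proof. by rewrite linearZ map_mxZ. Qed.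

Lemma trmxC1 : 1%:M ^t* = 1%:M :> 'M[C]_n.
Proof. by rewrite trmx1 map_mx1. Qed.

Lemma psdmx0 : psdmx (0 : 'M[C]_n).
Proof.
split; first by apply/hermsymmxP; rewrite trmx0 map_mx0.
by move=> v; rewrite mulmx0 mul0mx mxE.
Qed.

Lemma psdmxD A B : psdmx A -> psdmx B -> psdmx (A + B).
Proof.
case=> /hermsymmxP hA pA [/hermsymmxP hB pB]; split.
  by apply/hermsymmxP; rewrite trmxC_add hA hB.
by move=> v; rewrite mulmxDr mulmxDl mxE addr_ge0.
Qed.

Lemma psdmxZ (c : C) A : 0 <= c -> psdmx A -> psdmx (c *: A).
Proof.
move=> c0 [/hermsymmxP hA pA]; split.
  by apply/hermsymmxP; rewrite trmxC_scale hA geC0_conj.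
by move=> v; rewrite -scalemxAr -scalemxAl mxE mulr_ge0.
Qed.

Lemma psdmx_sum (I : finType) (F : I -> 'M[C]_n) :
  (forall k, psdmx (F k)) -> psdmx (\sum_k F k).
Proof.
by move=> pF; elim/big_ind: _ => //; [exact: psdmx0 | exact: psdmxD].
Qed.

Lemma psdmx_congr B A : psdmx A -> psdmx (B ^t* *m A *m B).
Proof.
case=> /hermsymmxP hA pA; split.
  by apply/hermsymmxP; rewrite !trmxC_mul trmxCK hA mulmxA.
by move=> v; have := pA (B *m v); rewrite trmxC_mul !mulmxA.
Qed.

(** The diagonal entries of a Gram matrix are sums of squared moduli. *)
Lemma gram_eq0 m p (M : 'M[C]_(m, p)) : M *m M ^t* = 0 -> M = 0.
Proof.
move=> M0; apply/matrixP => i j; rewrite !mxE.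
have /matrixP/(_ i i) := M0; rewrite !mxE => /eqP.
rewrite psumr_eq0 => [/allP/(_ j)|k _].
  rewrite mem_index_enum !mxE mul_conjC_eq0 => /(_ isT) /implyP /(_ isT).
  by move/eqP.
by rewrite !mxE mul_conjC_ge0.
Qed.

Lemma absmx_psd Z : psdmx (absmx Z).
Proof. by have [] := sqrtmxP (gram_psd Z). Qed.

Lemma absmx_herm Z : (absmx Z) ^t* = absmx Z.
Proof. by have [/hermsymmxP] := absmx_psd Z. Qed.

Lemma absmx_sqr Z : absmx Z *m absmx Z = Z ^t* *m Z.
Proof. by have [] := sqrtmxP (gram_psd Z). Qed.

End PositiveSemidefinite.

(** * Polar decomposition with a unitary factor *)

Section PolarDecomposition.
Variables (C : numClosedFieldType) (n : nat).
Implicit Types A B Z V W : 'M[C]_n.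

(** The complement has the explicit height [n - r], so that complements of two
    families of the same size can be matched row by row. *)
Lemma unitarymx_complete r (E : 'M[C]_(r, n)) : E \is unitarymx ->
  exists F : 'M[C]_(n - r, n),
    [/\ F \is unitarymx, E *m F ^t* = 0 & E ^t* *m E + F ^t* *m F = 1%:M].
Proof.
move=> uE; have rE := mxrank_unitary uE.
have le_rn : (r <= n)%N by rewrite -rE rank_leq_col.
have [F uF FE] : exists2 F : 'M[C]_(n - r, n), F \is unitarymx
    & F *m E ^t* = 0.
  have rk : (n - r)%N = \rank (kermx (E ^t*)).
    by rewrite mxrank_ker mxrank_map mxrank_tr rE.
  rewrite rk; exists (schmidt (row_base (kermx (E ^t*)))).
    by rewrite schmidt_unitarymx // rank_leq_col.
  by apply/sub_kermxP; rewrite eqmx_schmidt_free ?row_base_free // eq_row_base.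
have EF : E *m F ^t* = 0.
  by rewrite -[E]trmxCK -trmxC_mul FE trmx0 map_mx0.
exists F; split=> //.
have uEF : col_mx E F \is unitarymx.
  apply/unitarymxP; rewrite tr_col_mx map_row_mx mul_col_row.
  rewrite EF FE (unitarymxP uE) (unitarymxP uF).
  by rewrite -scalar_mx_block.
have := mulmxKtV 1%:M uEF (subnKC le_rn).
by rewrite mul1mx tr_col_mx map_row_mx mul_row_col.
Qed.

(** An orthonormal basis [E = K B] of the row space of [B] is carried to
    [F = K A]; equality of the Gram matrices makes [F] an orthonormal basis of
    the row space of [A].  Completing both to bases of the whole space gives
    the unitary matrix sending the first one to the second. *)
Lemma gram_eq_unitary A B : A *m A ^t* = B *m B ^t* ->
  exists2 W : 'M[C]_n, W \is unitarymx & A = B *m W.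
Proof.
move=> AB.
have [r [E uE eqE]] : exists r, exists2 E : 'M[C]_(r, n),
    E \is unitarymx & (E :=: B)%MS.
  exists (\rank B), (schmidt (row_base B)).
    by rewrite schmidt_unitarymx // rank_leq_col.
  apply: eqmx_trans (eq_row_base B).
  by apply: eqmx_schmidt_free; apply: row_base_free.
have /submxP[K EK] : (E <= B)%MS by rewrite eqE.
have BEE : B *m E ^t* *m E = B.
  have /submxP[L ->] : (B <= E)%MS by rewrite eqE.
  by rewrite -(mulmxA L) (unitarymxP uE) mulmx1.
set F := K *m A.
have uF : F \is unitarymx.
  apply/unitarymxP; rewrite /F trmxC_mul !mulmxA -(mulmxA K) AB.
  by rewrite !mulmxA -(mulmxA _ (B ^t*)) -trmxC_mul -EK (unitarymxP uE).
(* A - B E^* F = Q A where Q B = B - B E^* E = 0. *)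
have ABF : A = B *m E ^t* *m F.
  apply/eqP; rewrite -subr_eq0; apply/eqP.
  set Q := 1%:M - B *m E ^t* *m K.
  have QA : A - B *m E ^t* *m F = Q *m A by rewrite mulmxBl mul1mx !mulmxA.
  have QB : Q *m B = 0 by rewrite mulmxBl mul1mx -(mulmxA _ K) -EK BEE subrr.
  rewrite QA; apply: gram_eq0.
  by rewrite trmxC_mul !mulmxA -(mulmxA Q) AB !mulmxA QB !mul0mx.
clearbody F.
have [E' [uE' EE' sE]] := unitarymx_complete uE.
have [F' [uF' FF' _]] := unitarymx_complete uF.
exists (E ^t* *m F + E' ^t* *m F').
  have F'F : F' *m F ^t* = 0.
    by rewrite -[F']trmxCK -trmxC_mul FF' trmx0 map_mx0.
  apply/unitarymxP; rewrite trmxC_add !trmxC_mul !trmxCK mulmxDl !mulmxDr.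
  rewrite !mulmxA -!(mulmxA _ F) -!(mulmxA _ F') FF' F'F.
  rewrite (unitarymxP uF) (unitarymxP uF') !mulmx1 !mulmx0 !mul0mx.
  by rewrite addr0 add0r.
by rewrite mulmxDr !mulmxA -ABF -BEE -!(mulmxA _ E) EE' !(mulmx0, mul0mx) addr0.
Qed.

Lemma polar_unitary Z : exists2 W : 'M[C]_n, W \is unitarymx & Z = W *m absmx Z.
Proof.
have [|W uW ZW] := @gram_eq_unitary (Z ^t*) (absmx Z).
  by rewrite trmxCK absmx_herm absmx_sqr.
exists (W ^t*); first by rewrite trmxC_unitary.
by rewrite -[LHS]trmxCK ZW trmxC_mul absmx_herm.
Qed.

Lemma absmx_adj_polar Z W : W \is unitarymx -> Z = W *m absmx Z ->
  absmx (Z ^t*) = W *m absmx Z *m W ^t*.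
Proof.
move=> uW ZW; apply/esym/sqrtmx_unique; first exact: gram_psd.
  by rewrite -{1}[W]trmxCK; apply/psdmx_congr/absmx_psd.
rewrite trmxCK [in RHS]ZW trmxC_mul absmx_herm !mulmxA.
congr (_ *m _); rewrite -!mulmxA; congr (_ *m _).
have /unitarymxP/mulmx1C WW := uW.
by rewrite [W ^t* *m _]mulmxA WW mul1mx.
Qed.

End PolarDecomposition.

(** * Modulus of a sum *)

Section SumInequalities.
Variables (C : numClosedFieldType) (n : nat).
Implicit Types X V : 'M[C]_n.

(** This is the congruence of [|X|] by [t W^* V - 1], where [X = W |X|]. *)
Lemma psdmx_polar_square X V (t : C) : t^* = t ->
  psdmx (t ^+ 2 *: (V ^t* *m absmx (X ^t*) *m V) + absmx X
         - t *: (V ^t* *m X + X ^t* *m V)).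
Proof.
move=> tR; have [W uW XW] := polar_unitary X.
rewrite (absmx_adj_polar uW XW).
have XWt : X ^t* = absmx X *m W ^t* by rewrite {1}XW trmxC_mul absmx_herm.
have VX : V ^t* *m X = V ^t* *m W *m absmx X by rewrite -mulmxA -XW.
have := psdmx_congr (t *: (W ^t* *m V) - 1%:M) (absmx_psd X).
rewrite trmxC_sub trmxC_scale tR trmxC_mul trmxCK trmxC1 XWt VX.
congr psdmx.
rewrite !(mulmxBl, mulmxBr, mulmx1, mul1mx, =^~ scalemxAl, =^~ scalemxAr).
rewrite !mulmxA; apply/matrixP => i j; rewrite !mxE; ring.
Qed.

Variables (I : finType) (X : I -> 'M[C]_n) (V : 'M[C]_n).
Let S := \sum_k X k.
Hypotheses (uV : V \is unitarymx) (polarS : S = V *m absmx S).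

Lemma absmx_sum_le (t : C) : t^* = t ->
  loewner_le ((2 * t) *: absmx S)
    (t ^+ 2 *: (V ^t* *m (\sum_k absmx (X k ^t*)) *m V) + \sum_k absmx (X k)).
Proof.
move=> tR; have /unitarymxP/mulmx1C VV := uV.
have VS : V ^t* *m S = absmx S by rewrite polarS mulmxA VV mul1mx -polarS.
have SV : S ^t* *m V = absmx S by rewrite -[V]trmxCK -trmxC_mul VS absmx_herm.
have -> : (2 * t) *: absmx S = \sum_k t *: (V ^t* *m X k + X k ^t* *m V).
  rewrite -scaler_sumr big_split /= -mulmx_sumr -mulmx_suml.
  have -> : \sum_k X k ^t* = S ^t* by rewrite /S linear_sum raddf_sum.
  by rewrite VS SV -mulr2n -scaler_nat scalerA mulrC.
rewrite /loewner_le mulmx_sumr mulmx_suml scaler_sumr -big_split -sumrB /=.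
by apply: psdmx_sum => k; apply: psdmx_polar_square.
Qed.

Lemma absmx_adj_sum_le (t : C) : t^* = t ->
  loewner_le ((2 * t) *: absmx (S ^t*))
    (t ^+ 2 *: (\sum_k absmx (X k ^t*)) + V *m (\sum_k absmx (X k)) *m V ^t*).
Proof.
move=> tR; have VV := unitarymxP uV.
have := psdmx_congr (V ^t*) (absmx_sum_le tR).
rewrite trmxCK; congr psdmx; rewrite (absmx_adj_polar uV polarS).
rewrite mulmxBr mulmxDr mulmxBl mulmxDl -!scalemxAr -!scalemxAl !mulmxA VV.
by rewrite mul1mx -(mulmxA _ V) VV mulmx1.
Qed.

(** The values [t = 1 / (2 b)] and [t = 2 b] are the ones for which both
    [\sum_k |X k|] and [\sum_k |(X k)^*|] end up with weight [b / 2] where they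
    are not conjugated by [V], and with weight [1 / (8 b)] where they are. *)
Lemma symabsmx_sum_le (b : C) : 0 < b ->
  loewner_le (symabsmx S)
    (b *: (\sum_k symabsmx (X k))
     + (8 * b)^-1 *: (V *m (\sum_k absmx (X k)) *m V ^t*
                      + V ^t* *m (\sum_k absmx (X k ^t*)) *m V)).
Proof.
move=> b0; have b_ge0 := ltW b0; have b_neq0 : b != 0 by rewrite gt_eqF.
have tR : ((2 * b)^-1)^* = (2 * b)^-1.
  by rewrite geC0_conj // invr_ge0 mulr_ge0.
have sR : (2 * b)^* = 2 * b by rewrite geC0_conj // mulr_ge0.
have b2_ge0 : 0 <= b / 2 by rewrite divr_ge0.
have b8_ge0 : 0 <= (8 * b)^-1 by rewrite invr_ge0 mulr_ge0.
have := psdmxD (psdmxZ b2_ge0 (absmx_sum_le tR))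
               (psdmxZ b8_ge0 (absmx_adj_sum_le sR)).
rewrite /loewner_le /symabsmx -scaler_sumr big_split /=; congr psdmx.
move: (absmx S) (absmx (S ^t*)) (\sum_k absmx (X k)) => P Q B.
move: (\sum_k absmx (X k ^t*)) => A.
move: (V *m B *m V ^t*) (V ^t* *m A *m V) => B' A'.
by apply/matrixP => i j; rewrite !mxE; field.
Qed.

End SumInequalities.

Local Open Scope complex_scope.

Theorem theorem2p1 (R : realType) (n m : nat) (X : 'I_m -> 'M[R[i]]_n) :
  exists V : 'M[R[i]]_n, V \is unitarymx /\
    forall b : R, 0 < b ->
      loewner_le
        (symabsmx (\sum_(k < m) X k))
        (b%:C *: (\sum_(k < m) symabsmx (X k))
         + (1 / (8 * b))%:C *:
             (V *m (\sum_(k < m) absmx (X k)) *m V ^t*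
              + V ^t* *m (\sum_(k < m) absmx ((X k) ^t*)) *m V)).
Proof.
have [V uV polarS] := polar_unitary (\sum_(k < m) X k).
exists V; split=> // b b0.
have -> : (1 / (8 * b))%:C = (8 * b%:C)^-1.
  by rewrite div1r fmorphV rmorphM rmorph_nat.
by apply: symabsmx_sum_le => //; rewrite ltcR.
Qed.
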